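(* Consider a convex optimal path parameterization problem (COPP, as defined in the context) satisfying the compactness, Lipschitz, and admissible-control regularity assumptions of the context, and let $\{(\mathbf x_0^{p*},\mathbf u_0^{p*})\}_{p=0}^\infty$, $\mathbf x_0^{p*}=(\boldsymbol x_k^{p*})_{k=0}^N$, $\mathbf u_0^{p*}=(u_k^{p*})_{k=0}^{N-1}$, be the sequence of trial trajectories generated by the RDDP process (see context), with approximate value functions $\mathcal V_k^p$. Let $J_0(\mathbf x_0,\mathbf u_0)=\sum_{k=0}^{N-1}L_k(\boldsymbol x_k,u_k)+\Phi(\boldsymbol x_N)$ and $\varepsilon_{\mathrm{gap}}(\mathbf x_0^{p*},\mathbf u_0^{p*})=J_0(\mathbf x_0^{p*},\mathbf u_0^{p*})-\mathcal V_0^p(\boldsymbol x_0^{p*})$. Then the historical best cost $\min_{0\le p'\le p}J_0(\mathbf x_0^{p'*},\mathbf u_0^{p'*})$ converges, as $p\to\infty$, to the globally optimal value of the COPP; specifically, $$\liminf_{p\to\infty}\varepsilon_{\mathrm{gap}}(\mathbf x_0^{p*},\mathbf u_0^{p*})=0.$$ Furthermore, every accumulation point of the sequence $\{(\mathbf x_0^{p*},\mathbf u_0^{p*})\}_{p=0}^\infty$ is a globally optimal solution of the COPP; that is, any convergent subsequence (at least one exists, by compactness of the feasible set) converges to a globally optimal solution of the COPP.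
   Context: **Problem.** Fix integers $m\ge2$, $N\ge1$ and $\Delta_k>0$ for $0\le k\le N-1$. Let $\boldsymbol A_k\in\mathbb R^{(m-1)\times(m-1)}$ have entries $(\boldsymbol A_k)_{ij}=\Delta_k^{j-i}/(j-i)!$ for $j\ge i$ and $0$ otherwise, and let $\boldsymbol b_k\in\mathbb R^{m-1}$ have entries $(\boldsymbol b_k)_i=\Delta_k^{m-i}/(m-i)!$. The problem is to minimize $\sum_{k=0}^{N-1}L_k(\boldsymbol x_k,u_k)+\Phi(\boldsymbol x_N)$ over $\boldsymbol x_k\in\mathbb R^{m-1}$ ($0\le k\le N$), $u_k\in\mathbb R$ ($0\le k\le N-1$), subject to $\boldsymbol x_{k+1}=\boldsymbol A_k\boldsymbol x_k+\boldsymbol b_ku_k$, $\boldsymbol f_k(\boldsymbol x_k)\le\boldsymbol 0$, $\boldsymbol h_k(\boldsymbol x_k,u_k)\le\boldsymbol 0$ for $0\le k\le N-1$ (componentwise), $\boldsymbol x_0\in\mathcal X_0$, $\boldsymbol x_N\in\mathcal X_{\mathrm f}$. **Assumption (regularity).** $L_k,\Phi$ (real-valued) and $\boldsymbol f_k,\boldsymbol h_k$ (vector-valued) are locally Lipschitz; $\mathcal X_0$, $\mathcal X_{\mathrm f}$ and each set $\{(\boldsymbol x,u)\mid\boldsymbol f_k(\boldsymbol x)\le\boldsymbol 0,\ \boldsymbol h_k(\boldsymbol x,u)\le\boldsymbol 0\}$ are compact. **COPP.** In addition, $L_k,\Phi$ and all components of $\boldsymbol f_k,\boldsymbol h_k$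 are convex, $\mathcal X_0,\mathcal X_{\mathrm f}$ are convex, and the problem is feasible. **Reachable and control sets.** $\mathcal B_N=\mathcal X_{\mathrm f}$ and, for $k<N$, $\mathcal B_k$ is the set of $\boldsymbol x_k$ for which there exist $\boldsymbol x_{k+1},\dots,\boldsymbol x_N,u_k,\dots,u_{N-1}$ with $\boldsymbol x_{j+1}=\boldsymbol A_j\boldsymbol x_j+\boldsymbol b_ju_j$, $\boldsymbol f_j(\boldsymbol x_j)\le\boldsymbol0$, $\boldsymbol h_j(\boldsymbol x_j,u_j)\le\boldsymbol0$ for all $k\le j<N$, and $\boldsymbol x_N\in\mathcal X_{\mathrm f}$. For $\boldsymbol x_k\in\mathcal B_k$, $k<N$, $\mathcal C_k(\boldsymbol x_k)=\{u\in\mathbb R\mid\boldsymbol h_k(\boldsymbol x_k,u)\le\boldsymbol0,\ \boldsymbol A_k\boldsymbol x_k+\boldsymbol b_ku\in\mathcal B_{k+1}\}$. **Assumption (admissible controls).** For each $k<N$ and $\boldsymbol x\in\mathcal B_k$, $\mathcal C_k(\boldsymbol x)=[\underline u_k(\boldsymbol x),\bar u_k(\boldsymbol x)]$, where $\underline u_k$ and $-\bar u_k$ are convex and both $\underline u_k,\bar u_k$ are locally Lipschitz on $\mathcal B_k$. **RDDP process.** For each loop $p=0,1,2,\dots$ and each $k<N$ there is a nonempty finite set of sample points $\mathcal S_k^p\subset\mathcal B_k$, where $\mathcal S_k^0$ is arbitrary. *Backward pass:* $\mathcal V_N^p=\Phi$ on $\mathcal B_N$, and for $k=N-1,\dots,0$,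 for $\boldsymbol x\in\mathcal B_k$, $$\widehat{\mathcal V}_k^p(\boldsymbol x)=\min_{u\in\mathcal C_k(\boldsymbol x)}L_k(\boldsymbol x,u)+\mathcal V_{k+1}^p(\boldsymbol A_k\boldsymbol x+\boldsymbol b_ku),\qquad \mathcal V_k^p(\boldsymbol x)=\max_{\boldsymbol y\in\mathcal S_k^p}\big\{\widehat{\mathcal V}_k^p(\boldsymbol y)+\boldsymbol g(\boldsymbol y)^\top(\boldsymbol x-\boldsymbol y)\big\},$$ where $\boldsymbol g(\boldsymbol y)\in\partial^\circ\widehat{\mathcal V}_k^p(\boldsymbol y)$ is any chosen Clarke subgradient. Here, for a locally Lipschitz function $f$ on a convex set $\mathcal B$, $\partial^\circ f(\boldsymbol y)$ is the convex hull of all limits of gradients $\nabla f(\boldsymbol y_n)$ with $\boldsymbol y_n\to\boldsymbol y$, $\boldsymbol y_n$ in the relative interior of $\mathcal B$ and $f$ differentiable at $\boldsymbol y_n$ relative to the affine hull of $\mathcal B$ (gradients taken in the direction space of the affine hull). *Forward pass:* $\boldsymbol x_0^{p*}\in\arg\min_{\boldsymbol x\in\mathcal B_0\cap\mathcal X_0}\mathcal V_0^p(\boldsymbol x)$ and, for $k=0,\dots,N-1$, $u_k^{p*}\in\arg\min_{u\in\mathcal C_k(\boldsymbol x_k^{p*})}L_k(\boldsymbol x_k^{p*},u)+\mathcal V_{k+1}^p(\boldsymbol A_k\boldsymbol x_k^{p*}+\boldsymbol b_ku)$, $\boldsymbol x_{k+1}^{p*}=\boldsymbol A_k\boldsymbol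 x_k^{p*}+\boldsymbol b_ku_k^{p*}$. *Update:* $\mathcal S_k^{p+1}$ is any finite subset of $\mathcal B_k$ with $\mathcal S_k^{p+1}\supset\mathcal S_k^p\cup\{\boldsymbol x_k^{p*}\}$. *)

(* Defs.v *)
(* MathComp-Analysis, over an arbitrary R : realType. *)
From HB Require Import structures.
From mathcomp Require Import all_boot all_order all_algebra.
From mathcomp Require Import all_classical all_reals all_analysis.

Set Implicit Arguments.
Unset Strict Implicit.
Unset Printing Implicit Defensive.

Import Order.TTheory GRing.Theory Num.Theory.
Import numFieldNormedType.Exports.

Local Open Scope classical_set_scope.
Local Open Scope ring_scope.

Section Analysis.
Context {R : realType}.

Definition locally_lipschitz_on (V W : normedModType R) (A : set V)
    (f : V -> W) : Prop :=
  forall x, A x -> exists2 U, nbhs x U & [lipschitz f y | y in U `&` A].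

Definition is_minimum (A : set R) (v : R) : Prop := A v /\ lbound A v.
Definition is_maximum (A : set R) (v : R) : Prop := A v /\ ubound A v.

Definition argmin_on (T : Type) (A : set T) (f : T -> R) : set T :=
  [set x | A x /\ forall y, A y -> f x <= f y].

Definition affine_hull (E : lmodType R) (A : set E) : set E :=
  [set x | exists (q : nat) (w : 'I_q -> E) (t : 'I_q -> R),
    [/\ forall i, A (w i), \sum_i t i = 1 & x = \sum_i t i *: w i]].

Definition convex_hull (E : lmodType R) (A : set E) : set E :=
  [set x | exists (q : nat) (w : 'I_q -> E) (t : 'I_q -> R),
    [/\ forall i, A (w i), forall i, 0 <= t i, \sum_i t i = 1
      & x = \sum_i t i *: w i]].

Definition direction_space (E : lmodType R) (A : set E) : set E :=
  [set x - y | x in affine_hull A & y in affine_hull A].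

Definition relative_interior (E : normedModType R) (A : set E) : set E :=
  [set x | A x /\ within (affine_hull A) (nbhs x) A].

Definition dot (n : nat) (v w : 'cV[R]_n) : R := (v^T *m w) 0 0.

(* The norm of 'cV[R]_n is the sup norm, which defines the same notion of
   differentiability as the Euclidean one. *)
Definition is_relative_gradient (n : nat) (B : set 'cV[R]_n)
    (f : 'cV[R]_n -> R) (y v : 'cV[R]_n) : Prop :=
  direction_space B v /\
  forall e : R, 0 < e ->
    \forall z \near within (affine_hull B) (nbhs y),
      `|f z - f y - dot v (z - y)| <= e * `|z - y|.

(* f matters only on B: at a point of the relative interior of B, all nearby
   points of the affine hull are in B. *)
Definition clarke_subdifferential (n : nat) (B : set 'cV[R]_n)
    (f : 'cV[R]_n -> R) (y : 'cV[R]_n) : set 'cV[R]_n :=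
  convex_hull (E := 'cV[R]_n) [set v | exists ys gs : nat -> 'cV[R]_n,
    [/\ forall i, relative_interior B (ys i),
        forall i, is_relative_gradient B f (ys i) (gs i),
        ys @ \oo --> y
      & gs @ \oo --> v]].

Definition nonpos (q : nat) (v : 'cV[R]_q) : Prop := forall i, v i 0 <= 0.

End Analysis.

Record path_problem (R : realType) (m N : nat) := PathProblem {
  step : 'I_N -> R;
  step_gt0 : forall k, 0 < step k;
  dim_f : 'I_N -> nat;
  dim_h : 'I_N -> nat;
  stage_cost : 'I_N -> 'cV[R]_m.-1 * R -> R;
  terminal_cost : 'cV[R]_m.-1 -> R;
  constr_f : forall k : 'I_N, 'cV[R]_m.-1 -> 'cV[R]_(dim_f k);
  constr_h : forall k : 'I_N, 'cV[R]_m.-1 * R -> 'cV[R]_(dim_h k);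
  X0 : set 'cV[R]_m.-1;
  Xf : set 'cV[R]_m.-1
}.

(* A stage k < N, seen as the state index k, resp. k + 1, in {0, ..., N}. *)
Definition cur (N : nat) (k : 'I_N) : 'I_N.+1 := widen_ord (leqnSn N) k.
Definition nxt (N : nat) (k : 'I_N) : 'I_N.+1 := lift ord0 k.

(* The k-th state of (X, U) is the k-th column of X, and U 0 k is its k-th
   control; the matrix topology is that of componentwise convergence. *)
Definition trajectory (R : realType) (m N : nat) : Type :=
  ('M[R]_(m.-1, N.+1) * 'rV[R]_N)%type.

Section Problem.
Context {R : realType} {m N : nat}.
Variable P : path_problem R m N.
Local Notation state := 'cV[R]_m.-1.

Definition state_at (z : trajectory R m N) (k : 'I_N.+1) : state := col k z.1.
Definition control_at (z : trajectory R m N) (k : 'I_N) : R := z.2 0 k.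

(* A_mx and b_vec are the exact discretization, under an input held constant
   for time step P k, of a chain of m - 1 integrators. *)
Definition A_mx (k : 'I_N) : 'M[R]_m.-1 :=
  \matrix_(i, j) if (i <= j)%N then step P k ^+ (j - i) / (j - i)`!%:R else 0.

(* Matrix indices start at 0, whence the i.+1. *)
Definition b_vec (k : 'I_N) : state :=
  \col_i (step P k ^+ (m - i.+1) / (m - i.+1)`!%:R).

Definition dynamics (k : 'I_N) (x : state) (u : R) : state :=
  A_mx k *m x + u *: b_vec k.

Definition stage_constraint (k : 'I_N) : set (state * R) :=
  [set xu | nonpos (constr_f P k xu.1) /\ nonpos (constr_h P k xu)].

Definition admissible_from (k : 'I_N.+1) (z : trajectory R m N) : Prop :=
  forall j : 'I_N, (k <= j)%N ->
    state_at z (nxt j) = dynamics j (state_at z (cur j)) (control_at z j) /\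
    stage_constraint j (state_at z (cur j), control_at z j).

Definition feasible : set (trajectory R m N) :=
  [set z | [/\ admissible_from ord0 z, X0 P (state_at z ord0)
             & Xf P (state_at z ord_max)]].

Definition cost (z : trajectory R m N) : R :=
  \sum_(k < N) stage_cost P k (state_at z (cur k), control_at z k)
    + terminal_cost P (state_at z ord_max).

Definition optimal_value : R := inf [set cost z | z in feasible].

Definition globally_optimal : set (trajectory R m N) :=
  argmin_on feasible cost.

Definition regular : Prop :=
  [/\ forall k, locally_lipschitz_on setT (stage_cost P k : _ -> R^o),
      locally_lipschitz_on setT (terminal_cost P : _ -> R^o),
      (forall k, locally_lipschitz_on setT (constr_f P k)) /\
      (forall k, locally_lipschitz_on setT (constr_h P k)),
      compact (X0 P) /\ compact (Xf P)
    & forall k, compact (stage_constraint k)].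

Definition COPP : Prop :=
  [/\ (forall k, convex_function setT
         (stage_cost P k : (state * R^o)%type -> R^o)) /\
      convex_function setT (terminal_cost P : _ -> R^o),
      forall k i,
        convex_function setT (fun x : state => constr_f P k x i 0 : R^o),
      forall k i,
        convex_function setT
          (fun xu : (state * R^o)%type => constr_h P k xu i 0 : R^o),
      convex_set (X0 P) /\ convex_set (Xf P)
    & feasible !=set0].

(* The components of z before index k are unconstrained. *)
Definition reach_set (k : 'I_N.+1) : set state :=
  [set x | exists z : trajectory R m N,
    [/\ state_at z k = x, admissible_from k z & Xf P (state_at z ord_max)]].

Definition control_set (k : 'I_N) (x : state) : set R :=
  [set u | nonpos (constr_h P k (x, u)) /\ reach_set (nxt k) (dynamics k x u)].

Definition admissible_controls : Prop :=
  exists u_lo u_hi : 'I_N -> state -> R, forall k : 'I_N,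
    [/\ forall x, reach_set (cur k) x ->
          control_set k x = `[u_lo k x, u_hi k x]%classic,
        convex_function (reach_set (cur k)) (u_lo k : _ -> R^o),
        convex_function (reach_set (cur k)) (fun x => - u_hi k x : R^o),
        locally_lipschitz_on (reach_set (cur k)) (u_lo k : _ -> R^o)
      & locally_lipschitz_on (reach_set (cur k)) (u_hi k : _ -> R^o)].

(* The first index is the loop number p.  Vhat and V are total functions, but
   they are constrained, and used, only on the reach sets. *)
Record rddp_process (S : nat -> 'I_N -> set state)
    (g : nat -> 'I_N -> state -> state)
    (Vhat : nat -> 'I_N -> state -> R) (V : nat -> 'I_N.+1 -> state -> R)
    (z : nat -> trajectory R m N) : Prop := RddpProcess {
  samples_finite : forall p k, finite_set (S p k);
  samples_nonempty : forall p k, S p k !=set0;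
  samples_sub : forall p k, S p k `<=` reach_set (cur k);
  backward_terminal : forall p x, reach_set ord_max x ->
    V p ord_max x = terminal_cost P x;
  backward_min : forall p k x, reach_set (cur k) x ->
    is_minimum
      [set stage_cost P k (x, u) + V p (nxt k) (dynamics k x u)
      | u in control_set k x]
      (Vhat p k x);
  backward_subgradient : forall p k y, S p k y ->
    clarke_subdifferential (reach_set (cur k)) (Vhat p k) y (g p k y);
  backward_max : forall p k x, reach_set (cur k) x ->
    is_maximum [set Vhat p k y + dot (g p k y) (x - y) | y in S p k]
      (V p (cur k) x);
  forward_init : forall p,
    argmin_on (reach_set ord0 `&` X0 P) (V p ord0) (state_at (z p) ord0);
  forward_control : forall p (k : 'I_N), let x := state_at (z p) (cur k) in
    argmin_on (control_set k x)
      (fun u => stage_cost P k (x, u) + V p (nxt k) (dynamics k x u))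
      (control_at (z p) k);
  forward_state : forall p k,
    state_at (z p) (nxt k) =
      dynamics k (state_at (z p) (cur k)) (control_at (z p) k);
  samples_update : forall p k,
    S p k `|` [set state_at (z p) (cur k)] `<=` S p.+1 k
}.

Definition gap (V : nat -> 'I_N.+1 -> state -> R)
    (z : nat -> trajectory R m N) (p : nat) : R :=
  cost (z p) - V p ord0 (state_at (z p) ord0).

Definition best_cost (z : nat -> trajectory R m N) (p : nat) : R :=
  \big[Num.min/cost (z 0%N)]_(p' < p.+1) cost (z p').

End Problem.

(* Main.v *)
(* The lower models V_k^p need not increase with p, since cuts may be recomputed
   with other subgradients, so the argument uses equi-Lipschitz continuity
   instead of monotonicity.  By backward induction on k, the functions V_k^p and
   Vhat_k^p are convex and Lipschitz on the compact convex reach set, with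
   constants independent of p; hence the cuts support Vhat_k^p, so that
   V_k^p <= Vhat_k^p with equality on the sample points.  For i < j the state
   x_k^i is a sample point of loop j, so the defect
   (Vhat_k^j - V_k^j)(x_k^j) is at most a constant times |x_k^j - x_k^i|;
   by compactness it tends to 0 as j grows.  The gap of loop p telescopes into
   the sum over k of these defects, and V_0^p(x_0^p) bounds the cost of every
   feasible trajectory from below. *)
Require Import Defs.
From HB Require Import structures.
From mathcomp Require Import all_boot all_order all_algebra.
From mathcomp Require Import all_classical all_reals all_analysis.
From mathcomp Require Import lra.

Set Implicit Arguments.
Unset Strict Implicit.
Unset Printing Implicit Defensive.

Import Order.TTheory GRing.Theory Num.Theory.
Import numFieldNormedType.Exports.

Local Open Scope classical_set_scope.
Local Open Scope ring_scope.

(** * Lipschitz functions on compact sets *)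

Section Analysis.
Context {R : realType}.

Lemma convex_setE (E : lmodType R) (A : set E) : convex_set A ->
  forall x y (t : R), 0 <= t -> t <= 1 -> A x -> A y ->
  A (t *: x + (1 - t) *: y).
Proof.
move=> cA x y t t0 t1 Ax Ay.
by have := cA x y (Itv01 t0 t1); rewrite !inE; apply.
Qed.

Lemma convex_functionP (E : lmodType R) (D : set E) (f : E -> R^o) :
  convex_function D f <->
  forall x y (t : R), 0 <= t -> t <= 1 -> D x -> D y ->
  f (t *: x + (1 - t) *: y) <= t * f x + (1 - t) * f y.
Proof.
split=> [cf x y t t0 t1 Dx Dy|cf t x y]; last first.
  by rewrite !inE; apply: cf; [exact: ge0|exact: le1].
by have := cf (Itv01 t0 t1) x y; rewrite !inE; apply.
Qed.

Lemma lipschitzE (V W : normedModType R) (A : set V) (f : V -> W) (K : R) :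
  K.-lipschitz_A f <->
  forall x y, A x -> A y -> `|f x - f y| <= K * `|x - y|.
Proof.
by split=> [lf x y Ax Ay|lf [x y] [Ax Ay]]; [exact: (lf (x, y))|exact: lf].
Qed.


Lemma locally_lipschitz_sub (V W : normedModType R) (A B : set V) (f : V -> W) :
  A `<=` B -> locally_lipschitz_on B f -> locally_lipschitz_on A f.
Proof.
move=> AB lf x /AB /lf[U Ux lU]; exists U => //.
by apply: sub_lipschitz lU => Q QU -[y z] [] [Uy /AB By] [Uz /AB Bz]; exact: QU.
Qed.

Lemma locally_lipschitz_bound (V W : normedModType R) (A : set V) (f : V -> W) x :
  locally_lipschitz_on A f -> A x ->
  exists2 K, 0 < K & exists2 U, nbhs x U & K.-lipschitz_(U `&` A) f.
Proof.
move=> lf /lf[U Ux /pinfty_ex_gt0[K K0 lU]].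
by exists K => //; exists U.
Qed.

(** Around a diagonal point of [A * A] the local Lipschitz constant works; around a point [(x, y)]
    with [x != y] the increments of [f] stay bounded while the distance stays away from 0. The
    near-covering form of compactness merges these local bounds into a single constant. *)
Lemma compact_lipschitz (V W : normedModType R) (A : set V) (f : V -> W) :
  compact A -> locally_lipschitz_on A f ->
  exists2 K, 0 <= K & K.-lipschitz_A f.
Proof.
move=> cA lf.
suff /pinfty_ex_gt0[K K0 lK] : \forall K \near +oo, A `*` A `<=`
    [set xy | A xy.1 -> A xy.2 -> `|f xy.1 - f xy.2| <= K * `|xy.1 - xy.2|].
  exists K; first exact: ltW.
  by move=> xy Axy; apply: lK => //; case: Axy.
apply: (iffLR (compact_near_coveringP _) (compact_setX cA cA)) => -[x y] [/= Ax Ay].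
have [K K0 [U Ux /lipschitzE lU]] := locally_lipschitz_bound lf Ax.
have [->|xy] := eqVneq x y.
  have [L L0 [T Ty /lipschitzE lT]] := locally_lipschitz_bound lf Ay.
  exists (T `*` T, [set M | L <= M]).
    by split; [exists (T, T)|apply: nbhs_pinfty_ge; exact: gtr0_real].
  move=> [[z w] M] [[/= Tz Tw] LM] Az Aw.
  by apply: (@le_trans _ _ (L * `|z - w|)); [exact: lT|exact: ler_wpM2r].
have [L L0 [T Ty /lipschitzE lT]] := locally_lipschitz_bound lf Ay.
pose d := `|x - y|; have d0 : 0 < d by rewrite normr_gt0 subr_eq0.
(* For [z] and [w] within [d / 4] of [x] and [y], [C] bounds [|f z - f w|] by passing through [f x]
   and [f y], and [d / 2] bounds [|z - w|] from below, so [C / (d / 2)] is a Lipschitz constant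
   there. *)
pose C := K * (d / 4) + `|f x - f y| + L * (d / 4).
have C0 : 0 <= C / (d / 2).
  by rewrite divr_ge0// ?addr_ge0// ?mulr_ge0 ?divr_ge0// ltW.
have d40 : 0 < d / 4 by rewrite divr_gt0.
exists ((U `&` ball x (d / 4)) `*` (T `&` ball y (d / 4)),
    [set M | C / (d / 2) <= M]).
  split; last by apply: nbhs_pinfty_ge; exact: ger0_real.
  by exists (U `&` ball x (d / 4), T `&` ball y (d / 4)) => //; split;
    apply: filterI => //; exact: nbhsx_ballx.
move=> [[z w] M] [[/= [Uz xz] [Tw yw]] CM] Az Aw.
move: xz yw; rewrite -!ball_normE => /ltW xz /ltW yw.
have zw_ge : d / 2 <= `|z - w|.
  have : d <= `|x - z| + `|z - w| + `|y - w|.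
    rewrite (distrC y); apply: le_trans (ler_distD w _ _) _.
    by rewrite lerD2r; exact: ler_distD.
  by lra.
have fzw : `|f z - f w| <= C.
  have fx : `|f z - f x| <= K * `|x - z|.
    rewrite (distrC x); apply: lU; split => //; exact: nbhs_singleton.
  have fy : `|f y - f w| <= L * `|y - w|.
    by apply: lT; split => //; exact: nbhs_singleton.
  have : `|f z - f w| <= `|f z - f x| + `|f x - f y| + `|f y - f w|.
    apply: le_trans (ler_distD (f y) _ _) _.
    by rewrite lerD2r; exact: ler_distD.
  have := ler_wpM2l (ltW K0) xz; have := ler_wpM2l (ltW L0) yw.
  by rewrite /C; lra.
apply: (le_trans fzw).
have -> : C = C / (d / 2) * (d / 2) by rewrite divfK// gt_eqF// divr_gt0.
by apply: ler_pM => //; rewrite divr_ge0// ltW.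
Qed.

Lemma frequently_close (V : normedModType R) (A : set V) (x : nat -> V)
    (Q : nat -> Prop) (e : R) :
  compact A -> (forall n, A (x n)) -> (forall n, exists2 i, (n <= i)%N & Q i) ->
  0 < e -> exists i j, [/\ (i < j)%N, Q i, Q j & `|x j - x i| < e].
Proof.
move=> cA Ax frQ e0.
(* Since [Q] holds infinitely often, restricting [\oo] to [Q] gives a proper filter. It clusters at
   some [c] in [A], and any two visits of [Q] within [e / 2] of [c] are [e]-close. *)
have PF : ProperFilter (within Q \oo).
  apply: Build_ProperFilter_ex => B [n _ nB].
  by have [i ni Qi] := frQ n; exists i; exact: nB.
have e2 : 0 < e / 2 by rewrite divr_gt0.
have FA : (x @ within Q \oo) A by exists 0%N => //= n _ _; exact: Ax.
have [c [Ac xc]] := cA (x @ within Q \oo) _ FA.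
have near_c n : exists2 i, (n <= i)%N & Q i /\ `|c - x i| < e / 2.
  have Fn : (x @ within Q \oo) (x @` [set i | (n <= i)%N /\ Q i]).
    by exists n => // i /= ni Qi; exists i.
  have [_ [[i [ni Qi] <-] ci]] := xc _ _ Fn (nbhsx_ballx c _ e2).
  exists i => //; split => //.
  by rewrite -ball_normE in ci.
have [i _ [Qi ci]] := near_c 0%N; have [j ij [Qj cj]] := near_c i.+1.
exists i, j; split => //.
have := ler_distD c (x j) (x i); rewrite (distrC (x j) c); lra.
Qed.

(** If [d] exceeded some [e] infinitely often, two of these indices would have arbitrarily close
    points, and the hypothesis on the later one would make [d] small there. *)
Lemma revisit_cvg0 (V : normedModType R) (A : set V) (x : nat -> V)
    (d : nat -> R) (K : R) :
  compact A -> (forall n, A (x n)) -> (forall n, 0 <= d n) ->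
  (forall i j, (i < j)%N -> d j <= K * `|x j - x i|) -> d @ \oo --> 0.
Proof.
move=> cA Ax d0 dK; apply/cvgr0Pnorm_le => e e0; apply: contrapT => nd.
(* [K] may have any sign; [|K| + 1] is a positive upper bound by which [e] can be divided. *)
have K0 : 0 < `|K| + 1 by rewrite ltr_wpDl.
have frQ n : exists2 i, (n <= i)%N & e < d i.
  apply: contrapT => nn; apply: nd; exists n => // i /= ni.
  rewrite ger0_norm// leNgt; apply/negP => ei; apply: nn; exists i => //.
have [i [j [ij _ ej xij]]] := frequently_close cA Ax frQ (divr_gt0 e0 K0).
suff : d j <= e by rewrite leNgt ej.
apply: (le_trans (dK _ _ ij)); apply: (@le_trans _ _ ((`|K| + 1) * `|x j - x i|)).
  by apply: ler_wpM2r => //; have := ler_norm K; lra.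
by rewrite mulrC -ler_pdivlMr// ltW.
Qed.

End Analysis.

(** * Clarke subgradients of convex functions *)

Section Matrices.
Context {R : realType}.

Lemma mx_entry_le (m n : nat) (A : 'M[R]_(m, n)) i j : `|A i j| <= `|A|.
Proof.
rewrite [leRHS]mx_normrE.
exact: (le_bigmax _ (fun ij => `|A ij.1 ij.2|) (i, j)).
Qed.

Lemma mx_norm_leP (m n : nat) (A : 'M[R]_(m, n)) (K : R) : 0 <= K ->
  (forall i j, `|A i j| <= K) -> `|A| <= K.
Proof.
by move=> K0 AK; rewrite [leLHS]mx_normrE; apply/bigmax_leP.
Qed.

Lemma norm_mulmx_le (m n p : nat) (A : 'M[R]_(m, n)) (B : 'M[R]_(n, p)) :
  `|A *m B| <= n%:R * `|A| * `|B|.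
Proof.
apply: mx_norm_leP => [|i j]; first by rewrite !mulr_ge0.
rewrite mxE (le_trans (ler_norm_sum _ _ _))//.
rewrite -mulrA mulr_natl -[X in _ *+ X]card_ord -sumr_const ler_sum// => k _.
by rewrite normrM ler_pM// mx_entry_le.
Qed.

Lemma dotE (n : nat) (v w : 'cV[R]_n) : dot v w = \sum_i v i 0 * w i 0.
Proof. by rewrite /dot mxE; apply: eq_bigr => i _; rewrite mxE. Qed.

Lemma dotC (n : nat) (v w : 'cV[R]_n) : dot v w = dot w v.
Proof. by rewrite !dotE; apply: eq_bigr => i _; rewrite mulrC. Qed.

Lemma dotDr (n : nat) (v w w' : 'cV[R]_n) : dot v (w + w') = dot v w + dot v w'.
Proof. by rewrite /dot mulmxDr mxE. Qed.

Lemma dotZr (n : nat) (v w : 'cV[R]_n) (a : R) : dot v (a *: w) = a * dot v w.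
Proof. by rewrite /dot -scalemxAr mxE. Qed.

Lemma dot_suml (n q : nat) (t : 'I_q -> R) (v : 'I_q -> 'cV[R]_n) w :
  dot (\sum_i t i *: v i) w = \sum_i t i * dot (v i) w.
Proof.
rewrite dotC [in LHS]/dot mulmx_sumr summxE; apply: eq_bigr => i _.
by rewrite -scalemxAr mxE dotC.
Qed.

(** Cauchy-Schwarz for the sup norm; the dimension [n] is the price of not using the Euclidean
    norm. *)
Lemma norm_dot_le (n : nat) (v w : 'cV[R]_n) :
  `|dot v w| <= n%:R * `|v| * `|w|.
Proof.
apply: (le_trans (mx_entry_le _ 0 0)); apply: (le_trans (norm_mulmx_le _ _)).
rewrite -!mulrA ler_wpM2l// ler_wpM2r//.
by apply: mx_norm_leP => // i j; rewrite mxE mx_entry_le.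
Qed.

(** The square of the largest entry is one of the nonnegative terms of the sum. *)
Lemma norm_sqr_le_dot (n : nat) (v : 'cV[R]_n) : `|v| ^+ 2 <= dot v v.
Proof.
have [->|/mx_norm_neq0[[i j] /= vij]] := eqVneq `|v| 0.
  by rewrite expr0n dotE sumr_ge0// => i _; rewrite -expr2 sqr_ge0.
rewrite [`|v|]vij ord1 real_normK ?num_real// dotE (bigD1 i)//= expr2 lerDl.
by rewrite sumr_ge0// => k _; rewrite -expr2 sqr_ge0.
Qed.

Lemma cvg_entry (m n : nat) (T : Type) (F : set_system T) {FF : Filter F}
    (f : T -> 'M[R]_(m, n)) (A : 'M[R]_(m, n)) i j :
  f @ F --> A -> (fun x => f x i j) @ F --> A i j.
Proof.
move=> fA; apply: (cvg_comp f (fun M : 'M[R]_(m, n) => M i j) fA).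
exact: coord_continuous.
Qed.

Lemma cvg_dot (n : nat) (T : Type) (F : set_system T) {FF : Filter F}
    (f h : T -> 'cV[R]_n) (v w : 'cV[R]_n) :
  f @ F --> v -> h @ F --> w -> (fun x => dot (f x) (h x)) @ F --> dot v w.
Proof.
move=> fv hw; rewrite dotE.
under eq_fun do rewrite dotE.
apply: cvg_big => [|i _]; [exact: add_continuous|apply: cvgM].
  exact: cvg_entry.
exact: cvg_entry.
Qed.

End Matrices.

Section Subgradients.
Context {R : realType}.

Lemma sub_affine_hull (E : lmodType R) (B : set E) : B `<=` affine_hull B.
Proof.
move=> x Bx; exists 1%N, (fun=> x), (fun=> 1).
by rewrite !big_ord1 scale1r.
Qed.

Lemma affine_hull_shift (E : lmodType R) (B : set E) (x a b : E) (c : R) :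
  affine_hull B x -> affine_hull B a -> affine_hull B b ->
  affine_hull B (x + c *: (a - b)).
Proof.
move=> [p [w [t [Bw t1 ->]]]] [q [wa [ta [Bwa ta1 ->]]]] [r [wb [tb [Bwb tb1 ->]]]].
(* [mix] concatenates three families. The weights are those of [x], [c] times those of [a] and [- c]
   times those of [b], with total [1 + c - c = 1]. *)
pose mix T (f : 'I_p -> T) (g : 'I_q -> T) (h : 'I_r -> T) (i : 'I_(p + (q + r))) :=
  match fintype.split i with
  | inl j => f j
  | inr k => match fintype.split k with inl j => g j | inr j => h j end
  end.
have mixl T f g h j : mix T f g h (lshift _ j) = f j.
  by rewrite /mix (unsplitK (inl j)).
have mixm T f g h j : mix T f g h (rshift _ (lshift _ j)) = g j.
  by rewrite /mix (unsplitK (inr (lshift _ j))) (unsplitK (inl j)).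
have mixr T f g h j : mix T f g h (rshift _ (rshift _ j)) = h j.
  by rewrite /mix (unsplitK (inr (rshift _ j))) (unsplitK (inr j)).
exists (p + (q + r))%N, (mix _ w wa wb).
exists (mix _ t (fun j => c * ta j) (fun j => - c * tb j)); split.
- by move=> i; rewrite /mix; case: fintype.split => // k; case: fintype.split.
- rewrite !big_split_ord/=.
  under eq_bigr do rewrite mixl.
  under [X in _ + (X + _)]eq_bigr do rewrite mixm.
  under [X in _ + (_ + X)]eq_bigr do rewrite mixr.
  by rewrite -!mulr_sumr t1 ta1 tb1 !mulr1 subrr addr0.
- rewrite !big_split_ord/=.
  under [X in _ = X + _]eq_bigr do rewrite !mixl.
  under [X in _ = _ + (X + _)]eq_bigr do rewrite !mixm -scalerA.
  under [X in _ = _ + (_ + X)]eq_bigr do rewrite !mixr -scalerA.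
  by rewrite -!scaler_sumr scaleNr scalerBr.
Qed.

(* As v is a direction of the affine hull, f can be tested along v itself:
   |v|^2 <= dot v v is at most about K |v|. *)
Lemma relative_gradient_norm (n : nat) (B : set 'cV[R]_n) (f : 'cV[R]_n -> R)
    (K : R) y v : 0 <= K -> K.-lipschitz_B (f : _ -> R^o) ->
  relative_interior B y -> is_relative_gradient B f y v -> `|v| <= K.
Proof.
move=> K0 /lipschitzE lf [By Bn] [[a aB [b bB abv]] gv].
have [->|v0] := eqVneq v 0; first by rewrite normr0.
have nv0 : 0 < `|v| by rewrite normr_gt0.
apply/ler_addgt0Pr => e e0.
have /nbhs_ballP[d /= d0 dB] : nbhs y [set z | affine_hull B z ->
    B z /\ `|f z - f y - dot v (z - y)| <= e * `|z - y|].
  exact: filterI Bn (gv e e0).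
pose t := d / 2 / `|v|; have t0 : 0 < t by rewrite !divr_gt0.
pose z := y + t *: v.
have zy : z - y = t *: v by rewrite /z addrC addKr.
have Nzy : `|z - y| = t * `|v| by rewrite zy normrZ gtr0_norm.
have Az : affine_hull B z.
  by rewrite /z -abv; apply: affine_hull_shift => //; exact: sub_affine_hull.
have [Bz] : B z /\ `|f z - f y - dot v (z - y)| <= e * `|z - y|.
  apply: dB => //.
  by rewrite -ball_normE /ball_/= distrC Nzy /t divfK ?gt_eqF// gtr_pMr// invf_lt1// ltr1n.
rewrite /= Nzy zy dotZr => fzy.
have lzy : `|f z - f y| <= K * (t * `|v|) by rewrite -Nzy; exact: lf.
have tv0 : 0 < t * `|v| by rewrite mulr_gt0.
rewrite -(ler_pM2l tv0).
have vv : t * (`|v| * `|v|) <= t * dot v v.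
  by rewrite ler_pM2l// -expr2 norm_sqr_le_dot.
move: fzy lzy; rewrite !ler_norml => /andP[f1 f2] /andP[f3 f4].
by lra.
Qed.

(** By convexity the difference quotient of [f] from [y] towards [x] is at most [f x - f y], and for
    short steps it is close to [dot v (x - y)]. The tolerance [e / |x - y|] makes the error of a
    step [t] equal to [t * e]. *)
Lemma relative_gradient_support (n : nat) (B : set 'cV[R]_n)
    (f : 'cV[R]_n -> R) y v x : convex_set B -> convex_function B (f : _ -> R^o) ->
  B y -> is_relative_gradient B f y v -> B x ->
  f y + dot v (x - y) <= f x.
Proof.
move=> cB /convex_functionP cf By [_ gv] Bx.
have [->|xy] := eqVneq x y; first by rewrite subrr -(scale0r 0) dotZr mul0r addr0.
have nxy : 0 < `|x - y| by rewrite normr_gt0 subr_eq0.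
apply/ler_addgt0Pr => e e0.
have /nbhs_ballP[d /= d0 dB] : nbhs y [set z | affine_hull B z ->
    `|f z - f y - dot v (z - y)| <= e / `|x - y| * `|z - y|].
  exact: gv (divr_gt0 e0 nxy).
(* The bound 1 keeps [z] on the segment from [y] to [x], the other one keeps it in the ball of
   radius [d]. *)
pose t := Num.min 1 (d / 2 / `|x - y|).
have t0 : 0 < t by rewrite lt_min ltr01 !divr_gt0.
have t1 : t <= 1 by rewrite ge_min lexx.
have td : t <= d / 2 / `|x - y| by rewrite ge_min lexx orbT.
pose z := t *: x + (1 - t) *: y.
have zy : z - y = t *: (x - y).
  by rewrite /z scalerBl scale1r scalerBr addrCA [y + _]addrC addrK.
have Nzy : `|z - y| = t * `|x - y| by rewrite zy normrZ gtr0_norm.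
have Bz : B z by apply: convex_setE => //; exact: ltW.
have : ball y d z.
  rewrite -ball_normE /ball_/= distrC Nzy -ltr_pdivlMr//; apply: le_lt_trans td _.
  by rewrite ltr_pM2r ?invr_gt0// gtr_pMr// invf_lt1// ltr1n.
move=> /dB/(_ (sub_affine_hull Bz)).
rewrite zy dotZr normrZ gtr0_norm// mulrCA divfK ?gt_eqF// ler_norml => /andP[f1 _].
have f2 : f z <= t * f x + (1 - t) * f y by apply: cf => //; exact: ltW.
by rewrite -(ler_pM2l t0); lra.
Qed.

(** Both properties hold for relative gradients at nearby points of the relative interior, and both
    survive limits and convex combinations. *)
Lemma clarke_norm_support (n : nat) (B : set 'cV[R]_n) (f : 'cV[R]_n -> R)
    (K : R) y v : 0 <= K -> K.-lipschitz_B (f : _ -> R^o) ->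
  convex_set B -> convex_function B (f : _ -> R^o) -> B y ->
  clarke_subdifferential B f y v ->
  `|v| <= K /\ forall x, B x -> f y + dot v (x - y) <= f x.
Proof.
move=> K0 lf cB cf By [q [w [t [gw t0 t1 ->]]]].
have {gw} wP i : `|w i| <= K /\ forall x, B x -> f y + dot (w i) (x - y) <= f x.
  have [ys [gs [ri gr ysy gsw]]] := gw i; split.
    apply: (ler_cvg_to (cvg_norm gsw) (cvg_cst K)); apply: nearW => j /=.
    exact: (relative_gradient_norm K0 lf (ri j) (gr j)).
  move=> x Bx.
  (* [f] is controlled on [B] only, but the points [ys j] lie in [B]. *)
  have fys : f \o ys @ \oo --> f y.
    apply/cvgrPdist_le => e e0.
    have K1 : 0 < K + 1 by rewrite ltr_wpDl.
    near=> j.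
    have [Bj _] := ri j.
    move/lipschitzE : lf => /(_ _ _ By Bj) /le_trans; apply.
    apply: (@le_trans _ _ ((K + 1) * `|y - ys j|)).
      by rewrite ler_wpM2r// lerDl.
    rewrite mulrC -ler_pdivlMr//; near: j.
    by apply: (cvgr_dist_le _ _ ysy); rewrite divr_gt0.
  apply: (@ler_cvg_to _ \oo _ R (fun j => f (ys j) + dot (gs j) (x - ys j)) (fun=> f x)).
  - apply: cvgD => //; apply: cvg_dot => //.
    by apply: cvgB => //; exact: cvg_cst.
  - exact: cvg_cst.
  - apply: nearW => j; have [Bj _] := ri j.
    exact: (relative_gradient_support cB cf Bj (gr j) Bx).
split=> [|x Bx].
  apply: (le_trans (ler_norm_sum _ _ _)).
  rewrite -[leRHS]mul1r -t1 mulr_suml ler_sum// => i _.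
  by rewrite normrZ ger0_norm// ler_wpM2l//; have [] := wP i.
rewrite dot_suml -[f y]mul1r -[f x]mul1r -t1 !mulr_suml -big_split/= ler_sum// => i _.
by rewrite -mulrDr ler_wpM2l//; have [_] := wP i; exact.
Unshelve. all: by end_near. Qed.

End Subgradients.

(** * Reach sets *)

Section Continuity.
Context {R : realType}.

Lemma prod_norm_le (V W : normedModType R) (x : V * W) (K : R) :
  (`|x| <= K) = (`|x.1| <= K) && (`|x.2| <= K).
Proof. by rewrite prod_normE ge_max. Qed.

Lemma locally_lipschitz_continuous (V W : normedModType R) (f : V -> W) :
  locally_lipschitz_on setT f -> continuous f.
Proof.
move=> lf x; have [K K0 [U Ux /lipschitzE lU]] := locally_lipschitz_bound lf (I : setT x).
apply/cvgrPdist_le => e e0; near=> y.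
apply: (@le_trans _ _ (K * `|x - y|)).
  apply: lU; split => //; first exact: nbhs_singleton.
  by near: y.
rewrite mulrC -ler_pdivlMr//; near: y.
by apply: cvgr_dist_le => //; rewrite divr_gt0.
Unshelve. all: by end_near. Qed.

Lemma lipschitz_locally_lipschitz (V W : normedModType R) (f : V -> W) (K : R) :
  (forall x y, `|f x - f y| <= K * `|x - y|) -> locally_lipschitz_on setT f.
Proof.
move=> lf x _; exists setT; first exact: filterT.
exists `|K|; split => [|M KM]; first exact: num_real.
move=> [y z] _ /=; apply: (le_trans (lf _ _)); rewrite ler_wpM2r//.
by apply: (le_trans (ler_norm _)); exact: ltW.
Qed.

End Continuity.

Lemma backward_ind (N : nat) (Q : 'I_N.+1 -> Prop) :
  Q ord_max -> (forall k : 'I_N, Q (nxt k) -> Q (cur k)) -> forall k, Q k.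
Proof.
move=> QN QS k; have [n] := ubnP (N - k); elim: n => // n IH in k *.
move=> Nkn; have [kN|Nk] := ltnP k N.
  have -> : k = cur (Ordinal kN) by exact: val_inj.
  apply/QS/IH; rewrite /= /bump/= add1n subnS.
  by move: Nkn; rewrite ltnS; apply: leq_trans; rewrite ltn_predL subn_gt0.
by have -> : k = ord_max by apply/val_inj/eqP; rewrite eqn_leq Nk -ltnS ltn_ord.
Qed.

Section ReachSets.
Context {R : realType} {m N : nat}.
Variable P : path_problem R m N.
Local Notation state := 'cV[R]_m.-1.

Lemma nxt_val (k : 'I_N) : nxt k = k.+1 :> nat.
Proof. by []. Qed.

Lemma dynamics_conv k (t : R) x y u w :
  dynamics P k (t *: x + (1 - t) *: y) (t * u + (1 - t) * w) =
  t *: dynamics P k x u + (1 - t) *: dynamics P k y w.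
Proof.
rewrite /dynamics mulmxDr -!scalemxAr !scalerDr scalerDl -!scalerA.
by rewrite addrACA.
Qed.

Lemma dynamics_dist k x y u w :
  `|dynamics P k x u - dynamics P k y w| <=
  m.-1%:R * `|A_mx P k| * `|x - y| + `|b_vec P k| * `|u - w|.
Proof.
rewrite /dynamics opprD addrACA -mulmxBr -scalerBl.
apply: (le_trans (ler_normD _ _)); apply: lerD; first exact: norm_mulmx_le.
by rewrite normrZ mulrC.
Qed.

Lemma dynamics_continuous k :
  continuous (fun xu : state * R^o => dynamics P k xu.1 xu.2).
Proof.
apply: locally_lipschitz_continuous.
apply: (@lipschitz_locally_lipschitz _ _ _ _
  (m.-1%:R * `|A_mx P k| + `|b_vec P k|)).
move=> [x u] [y w] /=; apply: (le_trans (dynamics_dist _ _ _ _ _)).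
have : `|(x, u) - (y, w)| <= `|(x, u) - (y, w)| by [].
rewrite prod_norm_le /= => /andP[xy uw].
by rewrite mulrDl lerD// ler_wpM2l// mulr_ge0.
Qed.

Lemma reach_set_max : reach_set P ord_max = Xf P.
Proof.
rewrite predeqE => x; split=> [[z [<-]]//|Xx].
(* No stage starts at index [N], so any trajectory ending at [x] is a witness; this one is
   constant. *)
pose y : trajectory R m N := (\matrix_(i, j) x i 0, 0).
exists y; have -> : state_at y ord_max = x.
  by rewrite /state_at/=; apply/colP => i; rewrite !mxE.
by split => // j; rewrite leqNgt ltn_ord.
Qed.

(** The dynamic programming recursion, which lets the reach sets be studied one stage at a time by
    backward induction. *)
Lemma reach_set_curP k x : reach_set P (cur k) x <->
  exists u, stage_constraint P k (x, u) /\ reach_set P (nxt k) (dynamics P k x u).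
Proof.
split=> [[z [<- az fz]]|[u [xu [z [zk az fz]]]]].
  have [zk ck] := az k (leqnn _).
  exists (control_at z k); split=> //; exists z; split=> // j kj.
  by apply: az; exact: leq_trans kj.
(* Only the state and the control of index [k] are overwritten: admissibility from [k + 1] on does
   not read them. *)
pose y : trajectory R m N :=
  (\matrix_(i, j) (if j == cur k then x i 0 else z.1 i j),
   \row_j (if j == k then u else z.2 0 j)).
have yx j : state_at y j = if j == cur k then x else state_at z j.
  by rewrite /state_at/=; apply/colP => i; rewrite !mxE; case: ifP => // _; rewrite mxE.
have yu j : control_at y j = if j == k then u else control_at z j.
  by rewrite /control_at mxE.
have neq (j : 'I_N.+1) : (k < j)%N -> (j == cur k) = false.
  by move=> kj; apply/negbTE; rewrite -val_eqE/= gtn_eqF.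
exists y; split; first by rewrite yx eqxx.
  move=> j; rewrite leq_eqVlt => /predU1P[/= kj|kj].
    have -> : j = k by apply: val_inj.
    by rewrite !yx yu !eqxx neq// zk.
  rewrite !yx yu !neq//; last by rewrite nxt_val ltnS ltnW.
  have -> : (j == k) = false by apply/negbTE; rewrite -val_eqE/= gtn_eqF.
  exact: az.
by rewrite yx neq.
Qed.

(** The part of the constraint on the state alone is absent from [control_set]; it comes from [x]
    being in the reach set. *)
Lemma control_stage_constraint k x u : reach_set P (cur k) x ->
  control_set P k x u -> stage_constraint P k (x, u).
Proof. by move=> /reach_set_curP[w [[fx _] _]] [hu _]. Qed.

Hypothesis hcopp : COPP P.

Lemma stage_constraint_conv k x y u w (t : R) : 0 <= t -> t <= 1 ->
  stage_constraint P k (x, u) -> stage_constraint P k (y, w) ->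
  stage_constraint P k (t *: x + (1 - t) *: y, t * u + (1 - t) * w).
Proof.
move=> t0 t1 [/= fx hx] [/= fy hy]; have t1' : 0 <= 1 - t by rewrite subr_ge0.
have [_ cf ch _ _] := hcopp; split=> /= i.
  have /convex_functionP/(_ x y t t0 t1 I I)/le_trans := cf k i; apply.
  by rewrite -[leRHS]addr0 lerD// mulr_ge0_le0.
have /convex_functionP/(_ (x, u) (y, w) t t0 t1 I I)/le_trans := ch k i; apply.
by rewrite -[leRHS]addr0 lerD// mulr_ge0_le0.
Qed.

(** The constraints are convex and the dynamics linear, so mixing the controls with the weights of
    the states serves the mixed state. *)
Lemma reach_set_convex k : convex_set (reach_set P k).
Proof.
have [_ _ _ [_ cXf] _] := hcopp.
elim/(@backward_ind N): k => [|k cB]; first by rewrite reach_set_max.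
move=> x y t; rewrite !inE => /reach_set_curP[u [xu Bu]] /reach_set_curP[w [yw Bw]].
apply/reach_set_curP; exists (t%:num * u + (1 - t%:num) * w); split.
  exact: stage_constraint_conv.
have -> := dynamics_conv k t%:num x y u w.
exact: convex_setE.
Qed.

Lemma control_set_conv k x y u w (t : R) : 0 <= t -> t <= 1 ->
  reach_set P (cur k) x -> reach_set P (cur k) y ->
  control_set P k x u -> control_set P k y w ->
  control_set P k (t *: x + (1 - t) *: y) (t * u + (1 - t) * w).
Proof.
move=> t0 t1 Bx By Cx Cy; split.
  have [] // := stage_constraint_conv t0 t1 (control_stage_constraint Bx Cx)
    (control_stage_constraint By Cy).
rewrite dynamics_conv; apply: (convex_setE (@reach_set_convex (nxt k))) => //.
  by case: Cx.
by case: Cy.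
Qed.

End ReachSets.

Section Compactness.
Context {R : realType} {m N : nat}.
Variable P : path_problem R m N.
Hypothesis hreg : regular P.

(** Backward induction: by the recursion, a reach set is the projection of a closed part of the
    compact stage constraint. *)
Lemma reach_set_compact k : compact (reach_set P k).
Proof.
have [_ _ _ [_ cXf] cst] := hreg.
elim/(@backward_ind N): k => [|k cB]; first by rewrite reach_set_max.
have -> : reach_set P (cur k) = fst @` (stage_constraint P k `&`
    (fun xu => dynamics P k xu.1 xu.2) @^-1` reach_set P (nxt k)).
  rewrite predeqE => x; split=> [/reach_set_curP[u [xu Bu]]|].
    by exists (x, u).
  by move=> [[y u] [yu Bu] <-]; apply/reach_set_curP; exists u.
apply: continuous_compact.
  by apply: continuous_subspaceT => xu; exact: cvg_fst.
apply: compact_closedI => //; apply: closed_comp.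
  by move=> xu _; exact: dynamics_continuous.
by apply: compact_closed => //; exact: norm_hausdorff.
Qed.

End Compactness.

(** * Convergence of the RDDP process *)

Section Rddp.
Context {R : realType} {m N : nat}.
Variable P : path_problem R m N.
Local Notation state := 'cV[R]_m.-1.
Local Notation B := (reach_set P).
Hypotheses (hreg : regular P) (hcopp : COPP P) (hadm : admissible_controls P).
Variables (S : nat -> 'I_N -> set state) (g : nat -> 'I_N -> state -> state)
  (Vhat : nat -> 'I_N -> state -> R) (V : nat -> 'I_N.+1 -> state -> R)
  (z : nat -> trajectory R m N).
Hypothesis hrddp : rddp_process P S g Vhat V z.

Lemma Vhat_le p k x u : B (cur k) x -> control_set P k x u ->
  Vhat p k x <= stage_cost P k (x, u) + V p (nxt k) (dynamics P k x u).
Proof.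
by move=> Bx Cu; have [_] := backward_min hrddp p Bx; apply; exists u.
Qed.

Lemma Vhat_attained p k x : B (cur k) x -> exists2 u, control_set P k x u &
  Vhat p k x = stage_cost P k (x, u) + V p (nxt k) (dynamics P k x u).
Proof.
by move=> Bx; have [[u Cu <-] _] := backward_min hrddp p Bx; exists u.
Qed.

Lemma value_convex p k : convex_function (B k) (V p k : _ -> R^o).
Proof.
elim/(@backward_ind N): k => [|k _]; apply/convex_functionP => x y t t0 t1 Bx By;
    have Bxy := convex_setE (@reach_set_convex _ _ _ P hcopp _) t0 t1 Bx By.
  rewrite !(backward_terminal hrddp)//.
  have [[_ cPhi] _ _ _ _] := hcopp.
  by move/convex_functionP : cPhi; exact.
(* The cut that attains the maximum at the mixed point is affine and bounds the value function from
   below at both [x] and [y]. *)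
have [[s Ss <-] _] := backward_max hrddp p Bxy.
have [_ Vx] := backward_max hrddp p Bx; have [_ Vy] := backward_max hrddp p By.
have -> : t *: x + (1 - t) *: y - s = t *: (x - s) + (1 - t) *: (y - s).
  rewrite !scalerBr addrACA -opprD -[in RHS]scalerDl.
  by rewrite [t + _]addrC subrK scale1r.
rewrite dotDr !dotZr.
have := ler_wpM2l t0 (Vx _ (imageP _ Ss)).
have t1' : 0 <= 1 - t by rewrite subr_ge0.
by have := ler_wpM2l t1' (Vy _ (imageP _ Ss)); lra.
Qed.

(** Partial minimization of a jointly convex function: the mixture of two minimizers is a candidate
    at the mixed state. *)
Lemma Vhat_convex p k : convex_function (B (cur k)) (Vhat p k : _ -> R^o).
Proof.
apply/convex_functionP => x y t t0 t1 Bx By.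
have Bxy := convex_setE (@reach_set_convex _ _ _ P hcopp _) t0 t1 Bx By.
have [u Cu ->] := Vhat_attained p Bx; have [w Cw ->] := Vhat_attained p By.
have Cuw := control_set_conv hcopp t0 t1 Bx By Cu Cw.
apply: (le_trans (Vhat_le p Bxy Cuw)).
have [[cL _] _ _ _ _] := hcopp.
have := cL k; move/convex_functionP => /(_ (x, u) (y, w) t t0 t1 I I) L_le.
have [_ Bu] := Cu; have [_ Bw] := Cw.
have := @value_convex p (nxt k); move/convex_functionP => /(_ _ _ t t0 t1 Bu Bw).
rewrite -dynamics_conv => V_le.
by apply: (le_trans (lerD L_le V_le)); rewrite !mulrDr addrACA.
Qed.

(** A minimizer at [x] is moved into the control interval of [y], whose ends are Lipschitz in the
    state. The resulting constant depends only on [K] and the problem data, hence not on [p]. *)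
Lemma Vhat_lipschitz k (K : R) : 0 <= K ->
  (forall p, K.-lipschitz_(B (nxt k)) (V p (nxt k) : _ -> R^o)) ->
  exists2 K', 0 <= K' & forall p, K'.-lipschitz_(B (cur k)) (Vhat p k : _ -> R^o).
Proof.
move=> K0 lV; have [ulo [uhi /(_ k)[Ck _ _ llo lhi]]] := hadm.
have [lL _ _ _ cst] := hreg.
have cB : compact (B (cur k)) by exact: reach_set_compact.
have [Ml Ml0 /lipschitzE lipl] := compact_lipschitz cB llo.
have [Mh Mh0 /lipschitzE liph] := compact_lipschitz cB lhi.
have [KL KL0 /lipschitzE lipL] := compact_lipschitz (cst k)
  (locally_lipschitz_sub (@subsetT _ _) (lL k)).
pose M := Ml + Mh; have M0 : 0 <= M by rewrite addr_ge0.
pose a := m.-1%:R * `|A_mx P k|; have a0 : 0 <= a by rewrite mulr_ge0.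
(* When the state moves by [d] the control moves by at most [M * d]: the first term pays for the
   stage cost, the second for the displacement of the next state. *)
pose K' := KL * (1 + M) + K * (a + `|b_vec P k| * M).
have K'0 : 0 <= K' by rewrite addr_ge0// mulr_ge0// addr_ge0// mulr_ge0.
suff le p x y : B (cur k) x -> B (cur k) y ->
    Vhat p k y <= Vhat p k x + K' * `|x - y|.
  exists K' => // p; apply/lipschitzE => x y Bx By.
  suff : `|Vhat p k x - Vhat p k y| <= K' * `|x - y| by [].
  have := le p _ _ Bx By; have := le p _ _ By Bx; rewrite (distrC y) => le1 le2.
  by rewrite ler_norml; apply/andP; split; lra.
move=> Bx By; set d := `|x - y|; have d0 : 0 <= d by exact: normr_ge0.
(* [u] is a minimizer at [x]; [v] witnesses that the control interval of [y] is nonempty. *)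
have [u Cu ->] := Vhat_attained p Bx; have [v Cv _] := Vhat_attained p By.
(* w is the projection of u onto the control interval of y. *)
pose w := Num.max (ulo k y) (Num.min u (uhi k y)).
have : `[ulo k x, uhi k x]%classic u by rewrite -Ck.
have : `[ulo k y, uhi k y]%classic v by rewrite -Ck.
rewrite /= !in_itv/= => /andP[lov vhi] /andP[lou uhi'].
have lohi := le_trans lov vhi.
have Cw : control_set P k y w.
  by rewrite Ck//= in_itv/= /w le_max lexx/= ge_max lohi/= ge_min lexx orbT.
have uw : `|u - w| <= M * d.
  have l1 : `|ulo k x - ulo k y| <= Ml * d by exact: lipl.
  have l2 : `|uhi k x - uhi k y| <= Mh * d by exact: liph.
  have := mulr_ge0 Ml0 d0; have := mulr_ge0 Mh0 d0.
  move: l1 l2; rewrite /w /M mulrDl !ler_norml => /andP[? ?] /andP[? ?] ? ?.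
  by apply/andP; case: (leP u (uhi k y)) => ?; case: (leP (ulo k y) _) => ?; lra.
have L_le : stage_cost P k (y, w) <= stage_cost P k (x, u) + KL * (1 + M) * d.
  have := lipL _ _ (control_stage_constraint Bx Cu) (control_stage_constraint By Cw).
  have : `|(x, u) - (y, w)| <= (1 + M) * d.
    rewrite prod_norm_le /= mulrDl mul1r; apply/andP; split.
      by rewrite lerDl mulr_ge0.
    by apply: (le_trans uw); rewrite lerDr.
  move=> /(ler_wpM2l KL0); rewrite mulrA => h1 h2.
  have : `|stage_cost P k (x, u) - stage_cost P k (y, w)| <= KL * (1 + M) * d.
    exact: le_trans h2 h1.
  by rewrite ler_norml => /andP[? ?]; lra.
have V_le : V p (nxt k) (dynamics P k y w) <= V p (nxt k) (dynamics P k x u) +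
    K * (a + `|b_vec P k| * M) * d.
  have := lV p; move/lipschitzE => /(_ _ _ Cu.2 Cw.2) h1.
  have h2 : `|dynamics P k x u - dynamics P k y w| <= (a + `|b_vec P k| * M) * d.
    apply: (le_trans (dynamics_dist _ _ _ _ _ _)).
    by rewrite mulrDl lerD// -mulrA ler_wpM2l.
  have : `|V p (nxt k) (dynamics P k x u) - V p (nxt k) (dynamics P k y w)|
      <= K * (a + `|b_vec P k| * M) * d.
    by apply: (le_trans h1); rewrite -mulrA ler_wpM2l.
  by rewrite ler_norml => /andP[? ?]; lra.
apply: (le_trans (Vhat_le p By Cw)); rewrite /K' mulrDl.
by have := lerD L_le V_le; lra.
Qed.

Lemma cut_norm_support p k y (K : R) : 0 <= K ->
  K.-lipschitz_(B (cur k)) (Vhat p k : _ -> R^o) -> S p k y ->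
  `|g p k y| <= K /\
  forall x, B (cur k) x -> Vhat p k y + dot (g p k y) (x - y) <= Vhat p k x.
Proof.
move=> K0 lK Sy; exact: (clarke_norm_support K0 lK (@reach_set_convex _ _ _ P hcopp (cur k))
  (@Vhat_convex p k) (samples_sub hrddp Sy) (backward_subgradient hrddp Sy)).
Qed.

(** A maximum of cuts inherits the bound on their slopes, whatever their number; [m.-1] comes from
    bounding [dot] in the sup norm. Backward induction passes the constant from [V] at [k + 1] to
    [Vhat] at [k], then to [V] at [k]. *)
Lemma value_lipschitz k : exists2 K, 0 <= K &
  forall p, K.-lipschitz_(B k) (V p k : _ -> R^o).
Proof.
elim/(@backward_ind N): k => [|k [K K0 /(Vhat_lipschitz K0)[L L0 lL]]].
  have [_ lPhi _ _ _] := hreg.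
  have cB : compact (B ord_max) by exact: reach_set_compact.
  have [K K0 /lipschitzE lK] := compact_lipschitz cB
    (locally_lipschitz_sub (@subsetT _ _) lPhi).
  exists K => // p; apply/lipschitzE => x y Bx By.
  by rewrite !(backward_terminal hrddp)//; exact: lK.
exists (m.-1%:R * L); first by rewrite mulr_ge0.
move=> p; apply/lipschitzE => x y Bx By.
suff le x' y' : B (cur k) x' -> B (cur k) y' ->
    V p (cur k) x' <= V p (cur k) y' + m.-1%:R * L * `|x' - y'|.
  suff : `|V p (cur k) x - V p (cur k) y| <= m.-1%:R * L * `|x - y| by [].
  have := le _ _ Bx By; have := le _ _ By Bx; rewrite (distrC y) => le1 le2.
  by rewrite ler_norml; apply/andP; split; lra.
move=> Bx' By'; have [[s Ss <-] _] := backward_max hrddp p Bx'.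
(* The cut that is active at [x'] is also a lower bound at [y']. *)
have [_ /(_ _ (imageP _ Ss))Vy] := backward_max hrddp p By'.
have [gL _] := cut_norm_support L0 (lL p) Ss.
have -> : x' - s = (y' - s) + (x' - y') by rewrite [RHS]addrC addrA subrK.
rewrite dotDr addrA lerD//; apply: (le_trans (ler_norm _)).
apply: (le_trans (norm_dot_le _ _)).
by rewrite ler_wpM2r// ler_wpM2l.
Qed.

Lemma Vhat_lipschitz_unif k : exists2 K, 0 <= K &
  forall p, K.-lipschitz_(B (cur k)) (Vhat p k : _ -> R^o).
Proof. by have [K K0 /(Vhat_lipschitz K0)] := value_lipschitz (nxt k). Qed.

Lemma value_le_Vhat p k x : B (cur k) x -> V p (cur k) x <= Vhat p k x.
Proof.
move=> Bx; have [K K0 lK] := Vhat_lipschitz_unif k.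
have [[s Ss <-] _] := backward_max hrddp p Bx.
by have [_] := cut_norm_support K0 (lK p) Ss; exact.
Qed.

Lemma Vhat_le_value p k x : S p k x -> Vhat p k x <= V p (cur k) x.
Proof.
move=> Sx; have [_ Vx] := backward_max hrddp p (samples_sub hrddp Sx).
have := Vx _ (imageP _ Sx).
by rewrite subrr -(scale0r 0) dotZr mul0r addr0.
Qed.

(** * Trial trajectories, their defects and their gap *)

Lemma trial_reach p k : B k (state_at (z p) k).
Proof.
case: k => n; elim: n => [|n IH] nN.
  have -> : Ordinal nN = ord0 by exact: val_inj.
  by have [[]] := forward_init hrddp p.
have nN' : (n < N)%N by [].
have -> : Ordinal nN = nxt (Ordinal nN') by exact: val_inj.
by rewrite (forward_state hrddp); have [[]] := forward_control hrddp p (Ordinal nN').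
Qed.

Lemma trial_control p k :
  control_set P k (state_at (z p) (cur k)) (control_at (z p) k).
Proof. by have [] := forward_control hrddp p k. Qed.

Lemma trial_feasible p : feasible P (z p).
Proof.
split.
- move=> k _; split; first exact: (forward_state hrddp).
  exact: (control_stage_constraint (trial_reach p _) (trial_control p k)).
- by have [[]] := forward_init hrddp p.
- by have := trial_reach p ord_max; rewrite reach_set_max.
Qed.

Lemma trial_in_samples i j k : (i < j)%N -> S j k (state_at (z i) (cur k)).
Proof.
elim: j => // j IH; rewrite ltnS leq_eqVlt => /predU1P[->|ij];
  apply: (samples_update hrddp); first by right.
by left; exact: IH.
Qed.

Definition defect p k :=
  Vhat p k (state_at (z p) (cur k)) - V p (cur k) (state_at (z p) (cur k)).

Lemma defect_cvg0 k : (defect ^~ k) @ \oo --> 0.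
Proof.
have [K K0 lK] := Vhat_lipschitz_unif k; have [L L0 lL] := value_lipschitz (cur k).
(* At the earlier state, now a sample point, the defect function of loop [j] is at most 0; [K] and
   [L] bound the variation of its two terms from there to the current state. *)
apply: (@revisit_cvg0 _ _ _ (fun p => state_at (z p) (cur k)) _ (K + L)).
- exact: (reach_set_compact hreg (k := cur k)).
- by move=> p; exact: trial_reach.
- by move=> p; rewrite subr_ge0 value_le_Vhat//; exact: trial_reach.
move=> i j ij; rewrite /defect.
set x := state_at (z j) _; set y := state_at (z i) _.
have Bx : B (cur k) x by exact: trial_reach.
have By : B (cur k) y by exact: trial_reach.
have : `|Vhat j k x - Vhat j k y| <= K * `|x - y|.
  by have := lK j; move/lipschitzE; exact.
have : `|V j (cur k) x - V j (cur k) y| <= L * `|x - y|.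
  by have := lL j; move/lipschitzE; exact.
have := Vhat_le_value (trial_in_samples k ij).
by rewrite !ler_norml -/y => ? /andP[? ?] /andP[? ?]; lra.
Qed.

Lemma sum_nxt_cur (F : 'I_N.+1 -> R) :
  \sum_(k < N) F (nxt k) + F ord0 = \sum_(k < N) F (cur k) + F ord_max.
Proof. by rewrite addrC -big_ord_recl big_ord_recr. Qed.

(** The forward control attains the minimum defining [Vhat], so each defect is a stage cost plus a
    difference of consecutive values of [V]; these telescope down to the terminal cost. *)
Lemma gapE p : gap P V z p = \sum_(k < N) defect p k.
Proof.
have VhatE k : Vhat p k (state_at (z p) (cur k)) =
    stage_cost P k (state_at (z p) (cur k), control_at (z p) k) +
    V p (nxt k) (state_at (z p) (nxt k)).
  rewrite (forward_state hrddp); apply/eqP; rewrite eq_le Vhat_le/=; last 2 first.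
  - exact: trial_reach.
  - exact: trial_control.
  have [u Cu ->] := Vhat_attained p (trial_reach p (cur k)).
  by have [_] := forward_control hrddp p k; exact.
under eq_bigr do rewrite /defect VhatE.
rewrite sumrB big_split/= /gap /cost.
have := sum_nxt_cur (fun k => V p k (state_at (z p) k)).
rewrite (backward_terminal hrddp); last exact: trial_reach.
by lra.
Qed.

Lemma gap_cvg0 : gap P V z @ \oo --> 0.
Proof.
have -> : gap P V z = fun p => \sum_(k < N) defect p k.
  by apply/funext => p; exact: gapE.
have : (fun p => \sum_(k < N) defect p k) @ \oo --> \sum_(k < N) (0 : R).
  by apply: cvg_big => [|k _]; [exact: add_continuous|exact: defect_cvg0].
by rewrite big1.
Qed.

(** Sum over the stages of [V <= Vhat <= stage_cost + V], the last [V] being taken at the next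
    state. *)
Lemma value_le_cost p y : feasible P y -> V p ord0 (state_at y ord0) <= cost P y.
Proof.
move=> [ay y0 yN].
have By k : B k (state_at y k) by exists y; split => // j _; exact: ay.
have le k : V p (cur k) (state_at y (cur k)) <=
    stage_cost P k (state_at y (cur k), control_at y k) +
    V p (nxt k) (state_at y (nxt k)).
  have [yk [_ hk]] := ay k isT.
  apply: (le_trans (value_le_Vhat _ (By _))); rewrite yk; apply: Vhat_le => //.
  by split => //; rewrite -yk.
have := sum_nxt_cur (fun k => V p k (state_at y k)).
rewrite (backward_terminal hrddp)// /cost.
have : \sum_(k < N) V p (cur k) (state_at y (cur k)) <= \sum_(k < N) _ :=
  ler_sum _ (fun k _ => le k).
by rewrite big_split/=; lra.
Qed.

(** The left-hand side is [V p ord0] at the trial initial state, its minimum over all admissible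
    initial states. *)
Lemma trial_lower_bound p y : feasible P y -> cost P (z p) - gap P V z p <= cost P y.
Proof.
move=> fy; rewrite /gap subKr; apply: le_trans (value_le_cost p fy).
have [_] := forward_init hrddp p; apply.
by have [ay y0 yN] := fy; split => //; exists y.
Qed.

Lemma optimal_value_le y : feasible P y -> optimal_value P <= cost P y.
Proof.
move=> fy; apply: ge_inf; last by exists y.
(* [inf] is a lower bound once the set of costs is bounded below; loop 0 supplies such a bound. *)
by exists (cost P (z 0) - gap P V z 0) => _ [w fw <-]; exact: trial_lower_bound.
Qed.

(** The whole sequence of trial costs converges, not just the running minimum: it lies between the
    optimum and the optimum plus the gap. *)
Lemma cost_cvg_optimal : (fun p => cost P (z p)) @ \oo --> optimal_value P.
Proof.
apply: (@squeeze_cvgr _ _ _ _ (fun=> optimal_value P)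
    (fun p => optimal_value P + gap P V z p)).
- apply: nearW => p; apply/andP; split.
    by apply: optimal_value_le; exact: trial_feasible.
  rewrite -lerBlDr; apply: lb_le_inf; first by exists (cost P (z p)), (z p) => //; exact: trial_feasible.
  by move=> _ [w fw <-]; exact: trial_lower_bound.
- exact: cvg_cst.
- rewrite -[X in _ --> X]addr0; apply: cvgD; [exact: cvg_cst|exact: gap_cvg0].
Qed.

Lemma best_cost_cvg : best_cost P z @ \oo --> optimal_value P.
Proof.
apply: (@squeeze_cvgr _ _ _ _ (fun=> optimal_value P) (fun p => cost P (z p))).
- apply: nearW => p; apply/andP; split.
    by apply/bigmin_geP; split=> [|i _]; exact/optimal_value_le/trial_feasible.
  exact: (bigmin_le _ ord_max (fun i : 'I_p.+1 => cost P (z i))).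
- exact: cvg_cst.
- exact: cost_cvg_optimal.
Qed.

Lemma limn_einf_gap : limn_einf (fun p => (gap P V z p)%:E) = 0%E.
Proof.
have /cvg_limn_einf_sup[] // : (fun p => (gap P V z p)%:E) @ \oo --> 0%E.
by apply: cvg_EFin; [exact: nearW|exact: gap_cvg0].
Qed.

End Rddp.

(** * Accumulation points *)

Section Accumulation.
Context {R : realType}.

Lemma cluster_closed (T : topologicalType) (x : nat -> T) (c : T) (C : set T) :
  closed C -> (\forall n \near \oo, C (x n)) -> cluster (x @ \oo) c -> C c.
Proof. by move=> cC xC xc; apply: cC => U Uc; exact: xc. Qed.

Lemma increasing_seq_ge (phi : nat -> nat) n : increasing_seq phi -> (n <= phi n)%N.
Proof.
move=> /increasing_seqP mphi; elim: n => // n; rewrite -ltnS => /leq_trans; apply.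
exact: mphi.
Qed.

Lemma cvg_subseq_cluster (T : topologicalType) (x : nat -> T) (c : T)
    (phi : nat -> nat) :
  increasing_seq phi -> x \o phi @ \oo --> c -> cluster (x @ \oo) c.
Proof.
move=> mphi xc A U [n _ nA] /xc[n' _ n'U].
pose k := maxn n n'; exists (x (phi k)); split.
  apply: nA => /=; apply: leq_trans (increasing_seq_ge k mphi).
  exact: leq_maxl.
by apply: n'U => /=; exact: leq_maxr.
Qed.

(** Reduction to real sequences: 0 is a cluster point of the distances to [c], and a subsequence of
    distances tending to 0 is what is sought. *)
Lemma cluster_cvg_subseq (V : normedModType R) (x : nat -> V) (c : V) :
  cluster (x @ \oo) c ->
  exists2 phi : nat -> nat, increasing_seq phi & x \o phi @ \oo --> c.
Proof.
move=> xc; pose u n := `|c - x n|.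
have /cluster_eventually_cvg[phi mphi uphi] : cluster (u @ \oo) 0.
  apply/cluster_eventuallyP => e n e0.
  have [y [[p np <-] cy]] : (x @` [set p | (n <= p)%N]) `&` ball c e !=set0.
    by apply: xc; [exists n => // p np; exists p|exact: nbhsx_ballx].
  exists p => //; rewrite sub0r normrN normr_id ltW//.
  by rewrite -ball_normE in cy.
exists phi => //; apply/cvgrPdist_le => e e0.
near=> n; have : `|u (phi n)| <= e.
  by near: n; move/cvgr0Pnorm_le : uphi; exact.
by rewrite normr_id.
Unshelve. all: by end_near. Qed.

Lemma matrix_of_columns_continuous m n :
  continuous (fun v : 'rV['cV[R]_m]_n => \matrix_(i, j) v ord0 j i 0 : 'M[R]_(m, n)).
Proof.
move=> v U /nbhs_ballP[e /= e0 eU]; apply/nbhs_ballP; exists e => //= w [_ vw].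
by apply: eU; split => // i j; rewrite !mxE; have [_] := vw ord0 j; exact.
Qed.

(** Such a matrix is the continuous image of a row whose entries are column vectors, and a product
    of compact sets of entries is compact by [rV_compact]. *)
Lemma compact_columns m n (A : 'I_n -> set 'cV[R]_m) : (forall k, compact (A k)) ->
  compact [set M : 'M[R]_(m, n) | forall k, A k (col k M)].
Proof.
move=> cA.
have -> : [set M : 'M[R]_(m, n) | forall k, A k (col k M)] =
    (fun v : 'rV['cV[R]_m]_n => \matrix_(i, j) v ord0 j i 0) @`
    [set v : 'rV['cV[R]_m]_n | forall k, A k (v ord0 k)].
  rewrite predeqE => M; split=> [AM|[v Av <-] k].
    exists (\row_k col k M); first by move=> k /=; rewrite mxE; exact: AM.
    by apply/matrixP => i j; rewrite !mxE.
  suff -> : col k (\matrix_(i, j) v ord0 j i 0) = v ord0 k by [].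
  by apply/colP => i; rewrite !mxE.
apply: continuous_compact; last exact: rV_compact.
by apply: continuous_subspaceT => v; exact: matrix_of_columns_continuous.
Qed.

End Accumulation.

(** * Closedness of the feasible set, continuity of the cost, existence of cluster points *)

Section FeasibleSet.
Context {R : realType} {m N : nat}.
Variable P : path_problem R m N.
Local Notation state := 'cV[R]_m.-1.
Hypothesis hreg : regular P.

Lemma state_at_continuous k :
  continuous (fun y : 'M[R]_(m.-1, N.+1) * 'rV[R]_N => state_at y k).
Proof.
apply: locally_lipschitz_continuous.
apply: (@lipschitz_locally_lipschitz _ _ _ _ 1) => x y; rewrite mul1r.
have : `|x - y| <= `|x - y| by [].
rewrite prod_norm_le => /andP[xy _].
apply: mx_norm_leP => // i j; apply: le_trans xy.
by have := mx_entry_le (x.1 - y.1) i k; rewrite !mxE.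
Qed.

Lemma control_at_continuous k :
  continuous (fun y : 'M[R]_(m.-1, N.+1) * 'rV[R]_N => control_at y k : R^o).
Proof.
move=> y; apply: (cvg_entry (f := snd)); exact: cvg_snd.
Qed.

Lemma stage_continuous k :
  continuous (fun y : 'M[R]_(m.-1, N.+1) * 'rV[R]_N =>
    (state_at y (cur k), control_at y k) : state * R^o).
Proof.
move=> y; exact: (cvg_pair (@state_at_continuous (cur k) y)
  (@control_at_continuous k y)).
Qed.

Lemma closed_feasible : closed (feasible P : set ('M[R]_(m.-1, N.+1) * 'rV[R]_N)).
Proof.
have [_ _ _ [cX0 cXf] cst] := hreg.
have -> : (feasible P : set ('M[R]_(m.-1, N.+1) * 'rV[R]_N)) =
    (\bigcap_k ((fun y => state_at y (nxt k) -
         dynamics P k (state_at y (cur k)) (control_at y k)) @^-1` [set 0] `&`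
       (fun y => (state_at y (cur k), control_at y k)) @^-1` stage_constraint P k))
    `&` ((state_at ^~ ord0) @^-1` X0 P `&` (state_at ^~ ord_max) @^-1` Xf P).
  rewrite predeqE => y; split=> [[ay y0 yN]|[ay [y0 yN]]].
    split=> // k _; have [yk ck] := ay k isT; split => //=.
    by rewrite yk subrr.
  by split=> // k _; have [/= /subr0_eq ? ?] := ay k I.
have closedP (f : 'M[R]_(m.-1, N.+1) * 'rV[R]_N -> state) C :
    continuous f -> compact C -> closed (f @^-1` C).
  move=> cf cC; apply: closed_comp => [y _|]; first exact: cf.
  by apply: compact_closed => //; exact: norm_hausdorff.
apply: closedI; last by apply: closedI; apply: closedP => //; exact: state_at_continuous.
apply: closed_bigI => k _; apply: closedI.
  apply: closedP; last exact: compact_set1.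
  move=> y; apply: cvgB; first exact: state_at_continuous.
  exact: (cvg_comp _ (fun xu : state * R^o => dynamics P k xu.1 xu.2)
    (@stage_continuous k y) (@dynamics_continuous _ _ _ P k _)).
apply: closed_comp => [y _|]; first exact: stage_continuous.
by apply: compact_closed => //; exact: norm_hausdorff.
Qed.

Lemma cost_continuous :
  continuous (cost P : 'M[R]_(m.-1, N.+1) * 'rV[R]_N -> R^o).
Proof.
have [lL lPhi _ _ _] := hreg.
have cL k : continuous (fun y : 'M[R]_(m.-1, N.+1) * 'rV[R]_N =>
    stage_cost P k (state_at y (cur k), control_at y k) : R^o).
  move=> y; exact: (continuous_comp (@stage_continuous k y)
    (@locally_lipschitz_continuous _ _ _ _ (lL k) _)).
have cPhi : continuous (fun y : 'M[R]_(m.-1, N.+1) * 'rV[R]_N =>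
    terminal_cost P (state_at y ord_max) : R^o).
  move=> y; exact: (continuous_comp (@state_at_continuous ord_max y)
    (@locally_lipschitz_continuous _ _ _ _ lPhi _)).
move=> y; apply: cvgD; last exact: cPhi.
by apply: cvg_big => [|k _]; [exact: add_continuous|exact: cL].
Qed.

(** Feasible states lie in the compact reach sets, including the last one, and feasible controls in
    the compact projections of the stage constraints. *)
Lemma feasible_cluster (z : nat -> trajectory R m N) : (forall p, feasible P (z p)) ->
  exists zbar : trajectory R m N, cluster (z @ \oo) zbar.
Proof.
move=> fz; have [_ _ _ _ cst] := hreg.
pose KX := [set M : 'M[R]_(m.-1, N.+1) | forall k, reach_set P k (col k M)].
have cKX : compact KX by apply: compact_columns => k; exact: reach_set_compact.
pose C k := snd @` (stage_constraint P k : set (state * R^o)).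
pose KU := [set u : 'rV[R]_N | forall k, C k (u ord0 k)].
have cKU : compact KU.
  apply: (@rV_compact R^o) => k; apply: continuous_compact; last exact: cst.
  by apply: continuous_subspaceT => xu; exact: cvg_snd.
have [] := compact_setX cKX cKU (F := z @ \oo).
  exists 0%N => // p _; have [az z0 zN] := fz p; split=> /= k.
    by exists (z p); split=> // j _; exact: az.
  have [_ ck] := az k isT.
  by exists (state_at (z p) (cur k), control_at (z p) k).
by move=> zbar [_ zc]; exists zbar.
Qed.

End FeasibleSet.

Theorem theorem2 (R : realType) (m N : nat) (hm : (2 <= m)%N) (hN : (1 <= N)%N)
    (P : path_problem R m N)
    (hreg : regular P) (hcopp : COPP P) (hadm : admissible_controls P)
    (S : nat -> 'I_N -> set 'cV[R]_m.-1)
    (g : nat -> 'I_N -> 'cV[R]_m.-1 -> 'cV[R]_m.-1)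
    (Vhat : nat -> 'I_N -> 'cV[R]_m.-1 -> R)
    (V : nat -> 'I_N.+1 -> 'cV[R]_m.-1 -> R)
    (z : nat -> trajectory R m N)
    (hrddp : rddp_process P S g Vhat V z) :
  [/\ best_cost P z @ \oo --> optimal_value P,
      limn_einf (fun p => (gap P V z p)%:E) = 0%E,
      forall zbar : trajectory R m N,
        cluster (z @ \oo) zbar -> globally_optimal P zbar,
      forall (phi : nat -> nat) (zbar : trajectory R m N),
        increasing_seq phi -> z \o phi @ \oo --> zbar -> globally_optimal P zbar
    & exists (phi : nat -> nat) (zbar : trajectory R m N),
        increasing_seq phi /\ z \o phi @ \oo --> zbar].
Proof.
have fz p : feasible P (z p) by exact: (trial_feasible hrddp p).
have opt zbar : cluster (z @ \oo) zbar -> globally_optimal P zbar.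
  move=> zc; split.
    apply: (@cluster_closed _ z zbar (feasible P) _ _ zc).
      exact: closed_feasible.
    exact: nearW.
  move=> y fy; apply: le_trans (optimal_value_le hreg hcopp hadm hrddp fy).
  (* The sublevel set of [cost P] at [optimal_value P + e] is closed and contains all late trial
     trajectories, hence also [zbar]. *)
  apply/ler_addgt0Pr => e e0.
  apply: (@cluster_closed _ z zbar [set y | cost P y <= optimal_value P + e] _ _ zc).
    apply: (@closed_comp _ R^o (cost P) [set x | x <= optimal_value P + e]).
      by move=> x _; exact: cost_continuous.
    exact: closed_le.
  have := cost_cvg_optimal hreg hcopp hadm hrddp; move/cvgr_le; apply.
  by rewrite ltrDl.
split=> //.
- exact: (best_cost_cvg hreg hcopp hadm hrddp).
- exact: (limn_einf_gap hreg hcopp hadm hrddp).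
- by move=> phi zbar mphi /(cvg_subseq_cluster mphi)/opt.
have [zbar zc] := feasible_cluster hreg fz.
have [phi mphi phiz] := cluster_cvg_subseq (V := ('M[R]_(m.-1, N.+1) * 'rV[R]_N)%type) zc.
by exists phi, zbar.
Qed.
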